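(* Let $F$ be a non-abelian free group of finite rank with a fixed basis $S$, and let $F^+\subset F\setminus\{1\}$ be a subset containing precisely one of $g, g^{-1}$ for every $1\neq g\in F$. Then for every alternating quasimorphism $\varphi: F\to\mathbb{R}$ there is a unique family of real coefficients $(\alpha_w)_{w\in F^+}$ such that $\varphi(g)=\sum_{w\in F^+}\alpha_w H_w(g)$ for all $g\in F$; and there is a unique family of real coefficients $(\beta_w)_{w\in F^+}$ such that $\varphi(g)=\sum_{w\in F^+}\beta_w h_w(g)$ for all $g\in F$.
   Context: A quasimorphism of $F$ is a map $\varphi:F\to\mathbb{R}$ with $\sup_{g,h\in F}|\varphi(g)+\varphi(h)-\varphi(gh)|<\infty$; it is alternating if $\varphi(g^{-1})=-\varphi(g)$ for all $g$. Elements of $F$ are identified with reduced words in $S^{\pm1}$; $|w|$ is the word length. A product is reduced if there is no cancellation. $w$ is a subword of $g$ if $g=uwv$ as a reduced product. For $1\ne w\in F$: $C_w(g)$ is the number of (possibly overlapping) occurrences of $w$ as a subword of $g$, and $H_w(g)=C_w(g)-C_{w^{-1}}(g)$ (big Brooks quasimorphism). $c_w(g)$ is the maximal number of pairwise disjoint occurrences of $w$ as a subword of $g$, and $h_w(g)=c_w(g)-c_{w^{-1}}(g)$ (small Brooks quasimorphism). For fixed $g$, $H_w(g)$ and $h_w(g)$ are nonzero only for the finitely many $w$ with $|w|\le |g|$, so the sums are finite at each $g$. *)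

(* Defs.v *)
From HB Require Import structures.
From mathcomp Require Import all_boot all_order all_algebra.
From mathcomp Require Import all_classical all_reals.

Set Implicit Arguments.
Unset Strict Implicit.
Unset Printing Implicit Defensive.

Import Order.TTheory GRing.Theory Num.Theory.
Local Open Scope classical_set_scope.
Local Open Scope ring_scope.

Section FreeGroup.
Variable S : finType.

(* (s, false) stands for the generator s and (s, true) for its inverse. *)
Local Notation letter := (S * bool)%type.

Definition linv (a : letter) : letter := (a.1, ~~ a.2).

Lemma linvK : involutive linv.
Proof. by case=> s b; rewrite /linv negbK. Qed.

Definition reduced (w : seq letter) : bool := sorted (fun a b => b != linv a) w.

Record free_group := FreeWord { word :> seq letter; word_reduced : reduced word }.

HB.instance Definition _ := [isSub for word].
HB.instance Definition _ := [Countable of free_group by <:].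

(* Left multiplication of a reduced word by a letter. *)
Definition lmul (a : letter) (w : seq letter) : seq letter :=
  if w is b :: w' then if b == linv a then w' else a :: w else [:: a].

Lemma lmul_reduced a w : reduced w -> reduced (lmul a w).
Proof.
case: w => [|b w] //= rw; case: ifPn => [_|ab]; first exact: path_sorted rw.
by rewrite /reduced /= ab.
Qed.

Lemma lmul_id a w : reduced (a :: w) -> lmul a w = a :: w.
Proof. by case: w => [|b w] //= /andP[/negPf->]. Qed.

Lemma lmulK a w : reduced w -> lmul a (lmul (linv a) w) = w.
Proof.
case: w => [|b w] /=; first by rewrite eqxx.
rewrite linvK; case: (eqVneq b a) => [-> /lmul_id //|_ _] /=.
by rewrite eqxx.
Qed.

Lemma foldr_reduced u v : reduced v -> reduced (foldr lmul v u).
Proof. by move=> rv; elim: u => //= a u; apply: lmul_reduced. Qed.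

Definition free_mul (u v : free_group) : free_group :=
  FreeWord (foldr_reduced u (word_reduced v)).

Lemma inv_reduced (u : seq letter) : reduced u -> reduced (rev (map linv u)).
Proof.
rewrite /reduced rev_sorted sorted_map.
by rewrite -(@eq_sorted _ (fun a b => b != linv a)) // => a b /=;
   rewrite linvK eq_sym.
Qed.

Definition free_inv (u : free_group) : free_group :=
  FreeWord (inv_reduced (word_reduced u)).

Definition free_one : free_group := @FreeWord [::] isT.

Lemma foldr_lmul a u w : reduced w ->
  foldr lmul w (lmul a u) = lmul a (foldr lmul w u).
Proof.
case: u => [|b u] //= rw; case: eqP => [->|//].
by rewrite lmulK // foldr_reduced.
Qed.

Lemma free_mulA : associative free_mul.
Proof.
move=> u v [w rw]; apply: val_inj => /=.
by elim: (word u) => //= a s ->; rewrite foldr_lmul.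
Qed.

Lemma free_mul1g : left_id free_one free_mul.
Proof. by move=> u; apply: val_inj. Qed.

Lemma free_mulg1 : right_id free_one free_mul.
Proof.
move=> [u ru]; apply: val_inj => /=.
elim: u ru => //= a u IHu rau; rewrite IHu ?lmul_id //.
exact: path_sorted rau.
Qed.

Lemma free_mulVg : left_inverse free_one free_inv free_mul.
Proof.
move=> [u ru]; apply: val_inj => /=.
elim: u ru => //= a u IHu rau.
rewrite rev_cons foldr_rcons /= linvK eqxx IHu //.
exact: path_sorted rau.
Qed.

Lemma free_invK : involutive free_inv.
Proof.
move=> [u ru]; apply: val_inj => /=.
by rewrite map_rev revK -map_comp map_id_in // => a _ /=; rewrite linvK.
Qed.

Lemma free_mulgV : right_inverse free_one free_inv free_mul.
Proof. by move=> u; rewrite -{1}[u]free_invK free_mulVg. Qed.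

HB.instance Definition _ := isGroup.Build free_group
  free_mulA free_mul1g free_mulg1 free_mulVg free_mulgV.

(* F^+ : misses 1 and contains precisely one of g, g^-1 for every g <> 1. *)
Definition positive_part (P : set free_group) : Prop :=
  ~ P 1%g /\
  forall g : free_group, g <> 1%g -> (P g /\ ~ P (g^-1)%g) \/ (~ P g /\ P (g^-1)%g).

(* An occurrence of w in g is a reduced factorization g = u w v; it is encoded
   by its starting position i = |u|.  Subwords of reduced words are reduced,
   so no cancellation condition is needed. *)
Definition occurs_at (w g : free_group) (i : nat) : bool := prefix w (drop i g).

(* C_w(g) *)
Definition big_count (w g : free_group) : nat :=
  #|[set i : 'I_(size g).+1 | occurs_at w g i]%SET|.

(* Occurrences of w at positions i < j are disjoint iff i + |w| <= j. *)
Definition disjoint_occurrences (w g : free_group)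
    (A : {set 'I_(size g).+1}) : bool :=
  [forall i in A, occurs_at w g i] &&
  [forall i in A, forall j in A, (i < j)%N ==> (i + size w <= j)%N].

(* c_w(g) *)
Definition small_count (w g : free_group) : nat :=
  \max_(A : {set 'I_(size g).+1} | disjoint_occurrences w A) #|A|.

Variable R : realType.

(* H_w and h_w; only meaningful for w <> 1. *)
Definition big_brooks (w g : free_group) : R :=
  (big_count w g)%:R - (big_count (w^-1)%g g)%:R.

Definition small_brooks (w g : free_group) : R :=
  (small_count w g)%:R - (small_count (w^-1)%g g)%:R.

(* For fixed g, both are supported on finitely many w, so that the finitely
   supported sums over w (which default to 0 on infinite supports) are genuine. *)
Lemma size_freeV (w : free_group) : size (w^-1)%g = size w.
Proof. by rewrite /= size_rev size_map. Qed.

Lemma big_count_eq0 (w g : free_group) : (size g < size w)%N -> big_count w g = 0%N.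
Proof.
move=> gw; apply/eqP; rewrite cards_eq0; apply/eqP/setP => i.
rewrite !inE; apply/negP => /size_prefix; rewrite size_drop => h.
by have := leq_trans gw (leq_trans h (leq_subr _ _)); rewrite ltnn.
Qed.

Lemma small_le_big_count (w g : free_group) : (small_count w g <= big_count w g)%N.
Proof.
apply/bigmax_leqP => A /andP[/forallP hA _]; apply: subset_leq_card.
by apply/fintype.subsetP => i iA; rewrite inE; move: (hA i); rewrite iA.
Qed.

Lemma finite_short_words n : finite_set [set w : free_group | (size w <= n)%N].
Proof.
pose s := [seq val t | m <- iota 0 n.+1, t <- enum {: m.-tuple letter}].
have := @finite_preimage _ _ _ word (in2W val_inj) (finite_seq s).
apply: sub_finite_set => w /= wn; apply/allpairsPdep => /=.
exists (size w), (in_tuple w); split=> //; last by rewrite mem_enum.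
by rewrite -[_ :: _]/(iota 0 n.+1) mem_iota add0n ltnS.
Qed.

Lemma big_brooks_finite g : finite_set [set w | big_brooks w g != 0].
Proof.
apply: sub_finite_set (finite_short_words (size g)) => w /=.
apply: contraNT; rewrite -ltnNge => gw.
by rewrite /big_brooks !big_count_eq0 ?size_freeV // subrr.
Qed.

Lemma small_brooks_finite g : finite_set [set w | small_brooks w g != 0].
Proof.
have c0 (w : free_group) : (size g < size w)%N -> small_count w g = 0%N.
  by move=> /big_count_eq0 e; apply/eqP; rewrite -leqn0 -e small_le_big_count.
apply: sub_finite_set (finite_short_words (size g)) => w /=.
apply: contraNT; rewrite -ltnNge => gw.
by rewrite /small_brooks !c0 ?size_freeV // subrr.
Qed.

Definition quasimorphism (phi : free_group -> R) : Prop :=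
  exists D : R, forall g h, `|phi g + phi h - phi (g * h)%g| <= D.

Definition alternating (phi : free_group -> R) : Prop :=
  forall g, phi (g^-1)%g = - phi g.

End FreeGroup.

(* Main.v *)
(* An occurrence of w in g forces |w| <= |g|, and if |w| = |g| then w = g.
   Hence, ordered by word length, the matrix (H_w(g)) with w, g in F^+ is
   unitriangular with finitely many nonzero entries in each column, so the
   system phi(g) = sum_w alpha_w H_w(g), g in F^+, has a unique solution by
   recursion on |g|.  Both sides being alternating, it then holds on all of F.
   The same argument applies to h_w. *)
Require Import Defs.
From mathcomp Require Import all_boot all_order all_algebra.
From mathcomp Require Import all_classical all_reals.
From mathcomp Require Import zify.
Import Order.TTheory GRing.Theory Num.Theory.
Local Open Scope classical_set_scope.
Local Open Scope ring_scope.

(** Isolates the unknown [a j], leaving only unknowns of smaller size, as the recursion needs.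
    [fins] makes the sums genuine: a sum of infinite support would default to 0. *)
Lemma unitriangular_fsbigE {R : pzRingType} {I : choiceType} (s : I -> nat)
    (B : I -> I -> R) (fins : forall n, finite_set [set i | (s i <= n)%N])
    (triB : forall i j, (s j <= s i)%N -> B i j = (i == j)%:R) (a : I -> R) j :
  \sum_(i \in [set: I]) a i * B i j =
  a j + \sum_(i \in [set i | (s i < s j)%N]) a i * B i j.
Proof.
rewrite -(@fsbig_widen _ _ _ _ [set i | (s i <= s j)%N]) //; last first.
  move=> i /= [_ /negP]; rewrite -ltnNge => ji.
  rewrite triB 1?ltnW //; case: eqP ji => [->|_ _]; first by rewrite ltnn.
  by rewrite mulr0.
rewrite (fsbigD1 j) //= triB // eqxx mulr1; congr (_ + _).
apply/esym/fsbig_widen => [i /= ij|i /= [[ij nij] /negP]].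
  by split; [exact: ltnW|move=> eij; rewrite eij ltnn in ij].
by rewrite -leqNgt => ji; rewrite triB //; move/eqP/negPf: nij => ->; rewrite mulr0.
Qed.

Lemma unitriangular_solve {R : pzRingType} {I : choiceType} (s : I -> nat)
    (B : I -> I -> R) (fins : forall n, finite_set [set i | (s i <= n)%N])
    (triB : forall i j, (s j <= s i)%N -> B i j = (i == j)%:R) (b : I -> R) :
  exists! a : I -> R, forall j, b j = \sum_(i \in [set: I]) a i * B i j.
Proof.
(* The recursion on [s j] is made structural by fuel [n]. The default 0 is harmless, since
   [coef n j] is only used with [s j < n], where it does not depend on [n]. *)
pose fix coef (n : nat) (j : I) {struct n} : R := if n is m.+1 then
  b j - \sum_(i \in [set i | (s i < s j)%N]) coef m i * B i j else 0.
have coef_stable n m j : (s j < n)%N -> (s j < m)%N -> coef n j = coef m j.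
  elim: n m j => // n IHn [|m] j //= jn jm; congr (_ - _).
  by apply: eq_fsbigr => i; rewrite inE /= => ij; rewrite (IHn m) //; lia.
exists (fun j => coef (s j).+1 j); split=> [j|a aP].
  rewrite (unitriangular_fsbigE s) //=.
  rewrite [X in _ = _ - X + _](_ : _ = \sum_(i \in [set i | (s i < s j)%N])
    coef (s i).+1 i * B i j) ?subrK //.
  by apply: eq_fsbigr => i; rewrite inE /= => ij; rewrite (coef_stable _ (s i).+1).
(* Uniqueness, by strong induction on [s j]: equation [j] determines [a j] from the values at
   smaller indices. *)
apply/funext => j; have [n] := ubnP (s j); elim: n j => // n IHn j jn /=.
rewrite aP (unitriangular_fsbigE s) //.
rewrite [X in _ - X](_ : _ = \sum_(i \in [set i | (s i < s j)%N]) a i * B i j)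
  ?addrK //.
apply: eq_fsbigr => i; rewrite inE /= => ij.
by rewrite -IHn ?(coef_stable _ (s i).+1) //; lia.
Qed.

Section Occurrences.
Context {S : finType}.
Implicit Types w g : free_group S.

Lemma size_free_gt0 w : w <> 1%g -> (0 < size w)%N.
Proof. by move=> w1; rewrite lt0n size_eq0; apply/eqP => ew; apply/w1/val_inj. Qed.

(** Fails for the empty word, which is a prefix of [drop i g] even for [i] past the end of [g]. *)
Lemma occurs_at_bound w g i : w <> 1%g -> occurs_at w g i -> (i + size w <= size g)%N.
Proof. by move=> /size_free_gt0 w0 /size_prefix; rewrite size_drop /=; lia. Qed.

(** If $g=uwv$ then $g^{-1}=v^{-1}w^{-1}u^{-1}$, and the new position is $|v|$. *)
Lemma occurs_atV w g i : w <> 1%g -> occurs_at w g i ->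
  occurs_at (w^-1)%g (g^-1)%g (size g - size w - i).
Proof.
move=> w1 oi; have := occurs_at_bound w g i w1 oi.
case/prefixP: oi => v gE.
rewrite /occurs_at /= -{1 3}(cat_take_drop i (word g)) gE => ig.
have := size_drop i g; rewrite gE size_cat => sg.
rewrite !map_cat !rev_cat -catA drop_size_cat ?prefix_prefix //.
by rewrite size_rev size_map; move: ig; rewrite !size_cat size_take; lia.
Qed.

(** [inord] bridges two ordinal types whose bounds are equal but not convertible; its argument is
    always in range. *)
Definition reflect_occurrences w g (A : {set 'I_(size g).+1}) :
    {set 'I_(size (g^-1)%g).+1} :=
  ((fun i : 'I_(size g).+1 => inord (size g - size w - i)) @: A)%SET.

Lemma reflect_occurrencesP w g (A : {set 'I_(size g).+1}) : w <> 1%g ->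
    {in A, forall i : 'I_(size g).+1, occurs_at w g i} ->
  #|reflect_occurrences w g A| = #|A| /\
  (forall j, j \in reflect_occurrences w g A -> exists2 i : 'I_(size g).+1,
    i \in A & j = (size g - size w - i)%N :> nat).
Proof.
move=> w1 occA.
have val_inord (i : 'I_(size g).+1) :
    @inord (size (g^-1)%g) (size g - size w - i) = (size g - size w - i)%N :> nat.
  by rewrite inordK // size_freeV; lia.
split=> [|j /imsetP[i iA ->]]; last by exists i.
apply: card_in_imset => i j iA jA /(congr1 val) /=; rewrite !val_inord.
(* These bounds rule out truncated subtraction, which would break injectivity. *)
move: (occurs_at_bound _ _ _ w1 (occA _ iA)) (occurs_at_bound _ _ _ w1 (occA _ jA)).
by move=> bi bj eij; apply: val_inj => /=; lia.
Qed.

Lemma free_invg_neq1 w : w <> 1%g -> (w^-1)%g <> 1%g.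
Proof. by move=> w1 e; apply: w1; rewrite -[w]invgK e invg1. Qed.

Lemma big_countV w g : w <> 1%g -> big_count (w^-1)%g (g^-1)%g = big_count w g.
Proof.
(* Applied to the inverses as well, one inequality gives both. *)
suff le (u h : free_group S) : u <> 1%g ->
    (big_count u h <= big_count (u^-1)%g (h^-1)%g)%N.
  move=> w1; apply/eqP; rewrite eqn_leq le // andbT.
  by have := le _ (g^-1)%g (free_invg_neq1 w w1); rewrite !invgK.
move=> u1; pose A := [set i : 'I_(size h).+1 | occurs_at u h i]%SET.
have occA : {in A, forall i : 'I_(size h).+1, occurs_at u h i}.
  by move=> i; rewrite inE.
have [cA inA] := reflect_occurrencesP u h A u1 occA.
rewrite /big_count -/A -cA; apply/subset_leq_card/fintype.subsetP => j /inA[i iA ji].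
by rewrite inE ji; apply: occurs_atV => //; apply: occA.
Qed.

Lemma small_countV w g : w <> 1%g -> small_count (w^-1)%g (g^-1)%g = small_count w g.
Proof.
suff le (u h : free_group S) : u <> 1%g ->
    (small_count u h <= small_count (u^-1)%g (h^-1)%g)%N.
  move=> w1; apply/eqP; rewrite eqn_leq le // andbT.
  by have := le _ (g^-1)%g (free_invg_neq1 w w1); rewrite !invgK.
move=> u1; apply/bigmax_leqP => A /andP[/forall_inP occA /forall_inP disA].
have [<- inA] := reflect_occurrencesP u h A u1 occA.
apply: leq_bigmax_cond; apply/andP; split.
  by apply/forall_inP => j /inA[i iA ->]; apply: occurs_atV => //; apply: occA.
apply/forall_inP => _ /inA[i iA ->]; apply/forall_inP => _ /inA[j jA ->].
(* Reflection reverses order, so the original positions satisfy [j < i]. *)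
apply/implyP => ij; have /forall_inP/(_ i iA)/implyP dis := disA j jA.
have bi := occurs_at_bound _ _ _ u1 (occA _ iA).
by rewrite size_freeV; have := dis ltac:(lia); lia.
Qed.

Lemma big_count_long w g : w <> 1%g -> (size g <= size w)%N ->
  big_count w g = (w == g).
Proof.
move=> w1 gw; case: eqVneq gw => [<- _|neq gw].
  rewrite /big_count (_ : [set i | _]%SET = [set ord0]%SET) ?cards1 //.
  apply/setP => i; rewrite !inE; apply/idP/eqP => [/(occurs_at_bound _ _ _ w1) le|->].
    by apply: val_inj => /=; lia.
  by rewrite /occurs_at drop0 prefix_refl.
apply/eqP; rewrite cards_eq0; apply/eqP/setP => i; rewrite !inE.
apply: contraNF neq => oi; have le := occurs_at_bound _ _ _ w1 oi.
move: oi; rewrite /occurs_at (_ : nat_of_ord i = 0%N) ?drop0; last by lia.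
move=> /prefixP[v gE]; apply/eqP/val_inj => /=; rewrite gE.
suff /size0nil-> : size v = 0%N by rewrite cats0.
by move: gw; rewrite gE size_cat /=; lia.
Qed.

Lemma small_count_long w g : w <> 1%g -> (size g <= size w)%N ->
  small_count w g = (w == g).
Proof.
move=> w1 gw; apply/eqP; rewrite eqn_leq -big_count_long // small_le_big_count.
rewrite big_count_long //; case: eqVneq => // <-.
(* In the remaining case [w = g], the singleton of position 0 attains the count 1. *)
rewrite [leqLHS](esym (cards1 (@ord0 (size w)))); apply: leq_bigmax_cond; apply/andP; split.
  by apply/forall_inP => i /set1P->; rewrite /occurs_at drop0 prefix_refl.
by apply/forall_inP => i /set1P->; apply/forall_inP => j /set1P->.
Qed.

End Occurrences.

(** Treats both kinds of count at once: [countV] makes the Brooks functions alternating, and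
    [count_long] makes their matrix on [Fplus] unitriangular. *)
Lemma alternating_count_expansion {R : realType} {S : finType}
    (count : free_group S -> free_group S -> nat)
    (countV : forall w g, w <> 1%g -> count (w^-1)%g (g^-1)%g = count w g)
    (count_long : forall w g : free_group S, w <> 1%g -> (size g <= size w)%N ->
       count w g = (w == g))
    (Fplus : set (free_group S)) (hFplus : positive_part Fplus)
    (phi : free_group S -> R) (halt : alternating phi) :
  exists! alpha : Fplus -> R, forall g, phi g =
    \sum_(w \in [set: Fplus])
      alpha w * ((count (val w) g)%:R - (count (val w)^-1%g g)%:R).
Proof.
have [F1 FV] := hFplus.
pose H w g : R := (count w g)%:R - (count w^-1%g g)%:R.
have Fneq1 (w : Fplus) : val w <> 1%g.
  by move=> w1; apply: F1; rewrite -w1; exact: set_valP.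
have altH w : w <> 1%g -> alternating (H w).
  move=> w1 g; rewrite /H opprB -{1}(invgK w) !countV //.
  exact: free_invg_neq1.
have alt1 (f : free_group S -> R) : alternating f -> f 1%g = 0.
  by move=> /(_ 1%g); rewrite invg1 => /eqP; rewrite -addr_eq0 -mulr2n mulrn_eq0 => /eqP.
have [||a [aP aU]] := @unitriangular_solve R Fplus (fun w => size (val w))
    (fun w g => H (val w) (val g)) _ _ (fun g => phi (val g)).
- move=> n; apply: (finite_preimage _ (finite_short_words S n)).
  by move=> x y _ _; exact: val_inj.
- move=> w g gw; rewrite /H !count_long ?size_freeV //; last exact: free_invg_neq1.
  (* The inverse word contributes nothing: [Fplus] cannot contain both [w] and its inverse. *)
  rewrite (_ : (val w)^-1%g == val g = false) ?subr0 //; apply/eqP => wg.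
  have := FV _ (Fneq1 w); rewrite wg.
  have := set_valP w; have := set_valP g; tauto.
exists a; split=> [g|a' a'P]; last by apply: aU => g; rewrite a'P.
have [->|/eqP g1] := eqVneq g 1%g.
  rewrite (alt1 phi) // fsbig1 // => w _.
  by rewrite [X in _ * X](alt1 _ (altH _ (Fneq1 w))) mulr0.
case: (FV g g1) => [[Fg _]|[_ Fg]].
  exact: (aP (SigSub (mem_set Fg))).
(* Here the inverse of [g] lies in [Fplus]; its equation is negated on both sides. *)
rewrite -[LHS]opprK -halt (aP (SigSub (mem_set Fg))) -mulN1r mulr_fsumr.
by apply: eq_fsbigr => w _; rewrite [H _ _](altH _ (Fneq1 w)) !mulrN mulN1r opprK.
Qed.

Theorem theorem1p2 (R : realType) (S : finType)
    (nonabelian : exists g h : free_group S, (g * h)%g <> (h * g)%g)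
    (Fplus : set (free_group S)) (hFplus : positive_part Fplus)
    (phi : free_group S -> R)
    (hphi : quasimorphism phi) (halt : alternating phi) :
  (exists! alpha : Fplus -> R, forall g : free_group S,
     phi g = \sum_(w \in [set: Fplus]) alpha w * big_brooks R (val w) g) /\
  (exists! beta : Fplus -> R, forall g : free_group S,
     phi g = \sum_(w \in [set: Fplus]) beta w * small_brooks R (val w) g).
Proof.
split; apply: alternating_count_expansion => // w g.
- exact: big_countV.
- exact: big_count_long.
- exact: small_countV.
- exact: small_count_long.
Qed.
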